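(* Let $(X,\varphi)$ be a Cantor minimal system and let $(Z,\eta)$ be an odometer. Then there is at most one factor map (up to conjugacy) from $(X,\varphi)$ to $(Z,\eta)$; that is, if $\beta_1,\beta_2:(X,\varphi)\to(Z,\eta)$ are factor maps then there is a conjugacy $\gamma:(Z,\eta)\to(Z,\eta)$ such that $\beta_1=\gamma\circ\beta_2$.
   Context: A Cantor minimal system $(X,\varphi)$ is a minimal homeomorphism $\varphi$ of a space $X$ homeomorphic to the Cantor set. A factor map $(X,\varphi)\to(Y,\psi)$ is a continuous surjection $\alpha:X\to Y$ with $\alpha\circ\varphi=\psi\circ\alpha$; a conjugacy is a factor map that is a homeomorphism. For a sequence $(k_n)_{n\ge1}$ of positive integers, an odometer of type $(k_n)_{n\ge1}$ is the minimal system $(X,\varphi)$ with $X=\prod_{n=1}^\infty\{0,1,\ldots,k_n-1\}$ and $\varphi$ the addition of $(1,0,0,\ldots)$ with carrying (to the right). Trivial odometers, with $X$ finite (i.e. $k_n=1$ for all but finitely many $n$), are included. *)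

(* Defs.v *)
From HB Require Import structures.
From mathcomp Require Import all_boot all_order all_algebra.
From mathcomp Require Import all_classical all_reals topology cantor.

Set Implicit Arguments.
Unset Strict Implicit.
Unset Printing Implicit Defensive.

Local Open Scope classical_set_scope.

Definition homeomorphism (X Y : topologicalType) (f : X -> Y) : Prop :=
  continuous f /\
  exists g : Y -> X, [/\ continuous g, cancel f g & cancel g f].

Definition homeomorphic (X Y : topologicalType) : Prop :=
  exists f : X -> Y, homeomorphism f.

(* Invariance is [phi E = E]: the dynamics is that of the Z-action generated
   by the homeomorphism [phi]. *)
Definition minimal_homeomorphism (X : topologicalType) (phi : X -> X) : Prop :=
  homeomorphism phi /\
  forall E : set X, closed E -> phi @` E = E -> E = set0 \/ E = setT.

Definition cantor_minimal_system (X : topologicalType) (phi : X -> X) : Prop :=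
  homeomorphic X cantor_space /\ minimal_homeomorphism phi.

Definition factor_map (X Y : topologicalType) (phi : X -> X) (psi : Y -> Y)
    (alpha : X -> Y) : Prop :=
  [/\ continuous alpha, set_surj setT setT alpha &
      alpha \o phi = psi \o alpha].

Definition conjugacy (X Y : topologicalType) (phi : X -> X) (psi : Y -> Y)
    (alpha : X -> Y) : Prop :=
  factor_map phi psi alpha /\ homeomorphism alpha.

(* Digits are indexed from 0, so [k n] is the usual k_(n+1). *)
Definition odometer_space (k : nat -> nat) : Type :=
  prod_topology (fun n : nat => discrete_topology 'I_(k n)).

HB.instance Definition _ (k : nat -> nat) := Topological.on (odometer_space k).

(* [carry z n] is the carry entering position [n] when (1, 0, 0, ...) is added
   to [z]; the carry entering position 0 is the added 1 itself. *)
Fixpoint carry (k : nat -> nat) (z : odometer_space k) (n : nat) : bool :=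
  if n is m.+1 then carry z m && ((z m : 'I_(k m)).+1 == k m) else true.

(* [ordS] is the successor modulo [k n] on ['I_(k n)]. *)
Definition odometer_map (k : nat -> nat) (z : odometer_space k) :
    odometer_space k :=
  fun n => if carry z n then ordS (z n : 'I_(k n)) else z n.

(* Main.v *)
(* The odometer is the projective limit of the cyclic groups Z/(k_0 ... k_(n-1))
   with translation by 1, the residue at level n being read off the first n
   digits. At each level the difference beta1 - beta2 is locally constant and
   phi-invariant, hence constant by minimality. So beta1 x at level n depends
   only on beta2 x at level n, which yields a continuous gamma with
   beta1 = gamma o beta2; exchanging the roles of beta1 and beta2 gives its
   inverse. *)
Require Import Defs.
From mathcomp Require Import all_boot all_order all_algebra.
From mathcomp Require Import all_classical all_reals topology cantor.
From mathcomp Require Import zify.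

Set Implicit Arguments.
Unset Strict Implicit.
Unset Printing Implicit Defensive.

Local Open Scope classical_set_scope.

Section OdometerValue.
Variable k : nat -> nat.
Implicit Types z w : odometer_space k.

Definition weight (n : nat) : nat := (\prod_(i < n) k i)%N.

(* The residue of [z] at level [n]: its first [n] digits in mixed radix, least
   significant first. *)
Definition value (n : nat) (z : odometer_space k) : nat :=
  (\sum_(i < n) (z i : 'I_(k i)) * weight i)%N.

Lemma weightS n : weight n.+1 = (weight n * k n)%N.
Proof. by rewrite /weight big_ord_recr. Qed.

Lemma valueS n z :
  value n.+1 z = (value n z + (z n : 'I_(k n)) * weight n)%N.
Proof. by rewrite /value big_ord_recr. Qed.

Lemma value_lt n z : (value n z < weight n)%N.
Proof.
elim: n => [|n IH]; first by rewrite /value /weight !big_ord0.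
rewrite valueS weightS; have := ltn_ord (z n : 'I_(k n)); nia.
Qed.

(** The values at levels [n] and [n.+1] differ by digit [n] times [weight n], which is positive
    because it exceeds [value n z]. *)
Lemma value_inj z w : (forall n, value n z = value n w) -> z = w.
Proof.
move=> zw; apply: functional_extensionality_dep => n.
apply: (@ord_inj (k n)); have := zw n.+1; rewrite !valueS zw => /addnI /eqP.
by rewrite eqn_pmul2r ?(leq_ltn_trans _ (value_lt n z)) // => /eqP.
Qed.

Lemma odometer_digit n z :
  ((odometer_map z n : 'I_(k n)) + carry z n.+1 * k n =
   (z n : 'I_(k n)) + carry z n)%N.
Proof.
rewrite /odometer_map /=; case: (carry z n) => //=.
set i := (z n : 'I_(k n)); rewrite addn1.
have [->|ik] := eqVneq i.+1 (k n); first by rewrite modnn mul1n.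
by rewrite mul0n addn0 modn_small // ltn_neqAle ik ltn_ord.
Qed.

(** Multiplying the digit identities by their weights and summing makes the intermediate carries
    cancel. *)
Lemma value_odometer_carry n z :
  (value n (odometer_map z) + carry z n * weight n = (value n z).+1)%N.
Proof.
elim: n => [|n IH]; first by rewrite /value /weight !big_ord0.
by rewrite !valueS weightS; have := odometer_digit n z; nia.
Qed.

Lemma value_odometer n z :
  (value n (odometer_map z) = (value n z).+1 %[mod weight n])%N.
Proof. by rewrite -value_odometer_carry addnC modnMDl. Qed.

(** Only the first [n] digits matter, and each is locally constant since its factor is discrete. *)
Lemma near_value n z : \forall w \near z, value n w = value n z.
Proof.
elim: n => [|n IH]; first by near=> w; rewrite /value !big_ord0.
have zn : \forall w \near z, w n = z n.
  have := @proj_continuous nat (fun n => discrete_topology 'I_(k n)) n z.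
  by move/(_ _ (discrete_set1 (z n : discrete_topology 'I_(k n)))).
by apply: filterS2 IH zn => w; rewrite !valueS => -> ->.
Unshelve. all: by end_near. Qed.

Lemma continuous_odometer_space (Y : topologicalType)
    (g : Y -> odometer_space k) :
  (forall y n, \forall y' \near y, value n (g y') = value n (g y)) ->
  continuous g.
Proof.
move=> gn y; apply/cvg_sup => i A [B [[C oC <-] Cg CA]].
(* Levels [i] and [i.+1] together determine digit [i]. *)
apply: filterS2 (gn y i) (gn y i.+1) => y' e1 e2.
apply: CA => /=; suff -> : g y' i = g y i by [].
apply: (@ord_inj (k i)); move: e2; rewrite !valueS e1 => /addnI /eqP.
by rewrite eqn_pmul2r ?(leq_ltn_trans _ (value_lt i (g y))) // => /eqP.
Qed.

End OdometerValue.

Lemma minimal_invariant_closed (X : topologicalType) (phi : X -> X)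
    (P : X -> Prop) (x : X) :
  minimal_homeomorphism phi -> closed [set y | P y] ->
  (forall y, P (phi y) <-> P y) -> P x -> forall y, P y.
Proof.
move=> [[_ [psi [_ _ psiK]]] phimin] cP Pphi Px y.
have PE : phi @` [set y | P y] = [set y | P y].
  apply/seteqP; split=> [_ [u Pu <-]|u Pu] /=; first exact/Pphi.
  by exists (psi u); rewrite ?psiK //; apply/Pphi; rewrite psiK.
case: (phimin _ cP PE) => E; first by have : [set y | P y] x by []; rewrite E.
by have : [set: X] y by []; rewrite -E.
Qed.

Section FactorMaps.
Variables (X : topologicalType) (phi : X -> X) (k : nat -> nat).
Hypothesis phimin : minimal_homeomorphism phi.

(* [b1 x - b1 y = b2 x - b2 y] at level [n], without subtraction. *)
Lemma value_factor_sub (b1 b2 : X -> odometer_space k) (n : nat) (x y : X) :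
  factor_map phi (@odometer_map k) b1 ->
  factor_map phi (@odometer_map k) b2 ->
  (value n (b1 x) + value n (b2 y) = value n (b1 y) + value n (b2 x)
    %[mod weight k n])%N.
Proof.
move=> [cb1 _ /funeqP eb1] [cb2 _ /funeqP eb2].
pose P y := (value n (b1 x) + value n (b2 y) = value n (b1 y) + value n (b2 x)
  %[mod weight k n])%N.
suff: forall y, P y by apply.
(* [P] depends on its argument only through two locally constant values, so it defines a closed
   set. *)
have near_P (u : X) : \forall v \near u, P v <-> P u.
  have n1 : \forall v \near u, value n (b1 v) = value n (b1 u).
    exact: (cb1 u _ (near_value n (b1 u))).
  have n2 : \forall v \near u, value n (b2 v) = value n (b2 u).
    exact: (cb2 u _ (near_value n (b2 u))).
  by apply: filterS2 n1 n2 => v; rewrite /P /= => -> ->.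
apply: (minimal_invariant_closed phimin (x := x)) => //.
  move=> u /(_ _ (near_P u)) [v [Pv /= PvE]]; exact/PvE.
move=> u; rewrite /P.
have := eb1 u; have := eb2 u; rewrite /= => -> ->.
(* Replacing [u] by [phi u] adds 1 to both sides of the congruence. *)
have e1 : (value n (b1 x) + value n (odometer_map (b2 u)) =
    value n (b1 x) + value n (b2 u) + 1 %[mod weight k n])%N.
  by rewrite -modnDmr value_odometer modnDmr addnS addn1.
have e2 : (value n (odometer_map (b1 u)) + value n (b2 x) =
    value n (b1 u) + value n (b2 x) + 1 %[mod weight k n])%N.
  by rewrite -modnDml value_odometer modnDml addSn addn1.
rewrite e1 e2; split=> /eqP; last by rewrite -(eqn_modDr 1) => /eqP.
by rewrite eqn_modDr => /eqP.
Qed.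

(** Equal terms cancel in the congruence, and residues below [weight k n] that are congruent are
    equal. *)
Lemma value_factor_congr (b1 b2 : X -> odometer_space k) (n : nat) (x y : X) :
  factor_map phi (@odometer_map k) b1 ->
  factor_map phi (@odometer_map k) b2 ->
  value n (b2 x) = value n (b2 y) -> value n (b1 x) = value n (b1 y).
Proof.
move=> f1 f2 e; have /eqP := value_factor_sub n x y f1 f2.
by rewrite e eqn_modDr !modn_small ?value_lt // => /eqP.
Qed.

Lemma factor_through_factor (b1 b2 : X -> odometer_space k) :
  factor_map phi (@odometer_map k) b1 ->
  factor_map phi (@odometer_map k) b2 ->
  exists2 gamma : odometer_space k -> odometer_space k,
    continuous gamma & b1 = gamma \o b2.
Proof.
move=> f1 f2; have [_ sb2 _] := f2.
(* The section [s] need not be continuous: level [n] of [b1 (s z)] depends only on level [n] of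
   [z]. *)
have /choice [s sK] : forall z, exists x, b2 x = z.
  by move=> z; have [x _ <-] := sb2 z I; exists x.
exists (b1 \o s).
  apply: continuous_odometer_space => z n.
  apply: filterS (near_value n z) => w zw /=.
  by apply: (value_factor_congr f1 f2); rewrite !sK.
apply/funext => x /=; apply: value_inj => n.
by apply: (value_factor_congr f1 f2); rewrite sK.
Qed.

End FactorMaps.

Theorem proposition4p14 (X : topologicalType) (phi : X -> X)
    (k : nat -> nat) (beta1 beta2 : X -> odometer_space k) :
  cantor_minimal_system phi ->
  (forall n, (0 < k n)%N) ->
  factor_map phi (@odometer_map k) beta1 ->
  factor_map phi (@odometer_map k) beta2 ->
  exists gamma : odometer_space k -> odometer_space k,
    conjugacy (@odometer_map k) (@odometer_map k) gamma /\
    beta1 = gamma \o beta2.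
Proof.
move=> [_ phimin] _ f1 f2.
have [g cg b1E] := factor_through_factor phimin f1 f2.
have [h ch b2E] := factor_through_factor phimin f2 f1.
have [[_ s1 e1] [_ s2 e2]] := (f1, f2).
(* On the image of [beta2], which is everything, [h \o g \o beta2 = h \o beta1 = beta2]. *)
have hg : cancel g h.
  by move=> z; have [x _ <-] := s2 z I; rewrite {2}b2E b1E.
have gh : cancel h g.
  by move=> z; have [x _ <-] := s1 z I; rewrite {2}b1E b2E.
exists g; split=> //; split; last by split=> //; exists h.
split=> //; first by move=> z _; exists (h z).
(* Equivariance at [beta2 x]: both sides equal [beta1 (phi x)]. *)
apply/funext => z; have [x _ <-] := s2 z I.
have /(congr1 (@^~ x)) /= <- := e2.
have /(congr1 (@^~ x)) /= := e1.
by rewrite b1E.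
Qed.
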